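(* Let $\alpha>0$, $\beta>0$, $\gamma\ge0$, $0\le\phi\le1$ and let $X\sim\text{RPushBeta}(\alpha,\beta,\gamma,\phi)$. Then for all $k=1,2,3,\ldots$, $$\mathbb{E}(X^k)=\frac{\mathrm{B}(\alpha+k,\beta)}{\mathrm{B}(\alpha,\beta)}\cdot\frac{{}_2F_1(-\gamma,\beta,\alpha+\beta+k;\phi)}{{}_2F_1(-\gamma,\beta,\alpha+\beta;\phi)},$$ and this can be written in the alternative form $$\mathbb{E}(X^k)=\frac{\int_0^1 x^{\alpha+k-1}(1-x)^{\beta-1}(1-\phi+x\phi)^{\gamma}\,dx}{\int_0^1 x^{\alpha-1}(1-x)^{\beta-1}(1-\phi+x\phi)^{\gamma}\,dx}.$$
   Context: $\mathrm{B}$ is the beta function and ${}_2F_1(a,b,c;z)$ is the Gaussian hypergeometric function with numerator parameters $a,b$ and denominator parameter $c$. For $\alpha>0$, $\beta>0$, $\gamma\ge 0$, $0\le\phi\le 1$, the right-pushed beta distribution $\text{RPushBeta}(\alpha,\beta,\gamma,\phi)$ is the continuous distribution on the unit interval with density $$\text{RPushBeta}(x|\alpha,\beta,\gamma,\phi)=\frac{x^{\alpha-1}(1-x)^{\beta-1}(1-\phi+x\phi)^{\gamma}}{\int_0^1 t^{\alpha-1}(1-t)^{\beta-1}(1-\phi+t\phi)^{\gamma}\,dt}=\frac{x^{\alpha-1}(1-x)^{\beta-1}(1-\phi+x\phi)^{\gamma}}{\mathrm{B}(\alpha,\beta)\,{}_2F_1(-\gamma,\beta,\alpha+\beta;\phi)},\qquad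 0\le x\le 1$$ (the two expressions agree by Euler's integral formula). *)

(* Defs.v *)
From HB Require Import structures.
From mathcomp Require Import all_boot all_order all_algebra.
From mathcomp Require Import all_classical all_reals all_analysis.

Set Implicit Arguments.
Unset Strict Implicit.
Unset Printing Implicit Defensive.

Import Order.TTheory GRing.Theory Num.Theory.
Import numFieldNormedType.Exports.

Local Open Scope classical_set_scope.
Local Open Scope ring_scope.

(* The library's [beta_fun] only takes natural-number arguments. *)
Definition Beta {R : realType} (a b : R) : R :=
  \int[lebesgue_measure]_(t in `[0, 1]) (t `^ (a - 1) * (1 - t) `^ (b - 1)).

Definition rising {R : realType} (a : R) (n : nat) : R :=
  \prod_(i < n) (a + i%:R).

(* Sum of the Gauss series. It is meaningful when the series converges: for
   `|z| < 1, and also at z = 1 when c - a - b > 0 (c not in {0, -1, -2, ...});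
   no analytic continuation outside the disk is attempted. *)
Definition hyp2F1 {R : realType} (a b c z : R) : R :=
  limn (series (fun n : nat =>
    rising a n * rising b n / rising c n * (z ^+ n / n`!%:R))).

Definition rpushbeta_kernel {R : realType} (alpha beta gamma phi x : R) : R :=
  x `^ (alpha - 1) * (1 - x) `^ (beta - 1) * (1 - phi + x * phi) `^ gamma.

(* At x = 0 and x = 1 the values follow the convention 0 `^ p = (p == 0)%:R,
   also for p < 0; these two points are Lebesgue-negligible. *)
Definition rpushbeta_pdf {R : realType} (alpha beta gamma phi : R) : R -> R :=
  (fun x => rpushbeta_kernel alpha beta gamma phi x /
     \int[lebesgue_measure]_(t in `[0, 1])
       rpushbeta_kernel alpha beta gamma phi t) \_ `[0, 1].

Definition rpushbeta_prob {R : realType} (alpha beta gamma phi : R) :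
    set R -> \bar R :=
  fun A => (\int[lebesgue_measure]_(x in A)
    (rpushbeta_pdf alpha beta gamma phi x)%:E)%E.

Definition is_rpushbeta {d : measure_display} {T : measurableType d}
    {R : realType} (P : probability T R) (X : {RV P >-> R})
    (alpha beta gamma phi : R) : Prop :=
  forall A : set R, measurable A ->
    distribution P X A = rpushbeta_prob alpha beta gamma phi A.

(* Main.v *)
Require Import Defs.
From HB Require Import structures.
From mathcomp Require Import all_boot all_order all_algebra.
From mathcomp Require Import all_classical all_reals all_analysis.
From mathcomp Require Import measurable_realfun ring lra.

(** By the density, E(X^k) is the integral of x^k times the kernel, divided by
    the integral of the kernel, and x^k x^(alpha-1) = x^(alpha+k-1): this is the
    second formula. The first one follows from Euler's formula: expand
    (1 - phi (1 - x))^gamma by the binomial series and integrate term by term,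
    using Beta(a, b + n) = (b)_n / (a + b)_n Beta(a, b), which comes from
    integrating the derivative of x^a (1 - x)^b over [0, 1]. The exchange is by
    dominated convergence, since for gamma >= 0 the binomial coefficients are
    absolutely summable; this also covers phi = 1. The binomial series itself is
    identified with (1 - y)^gamma on [0, 1) through the equation
    (1 - y) f' = - gamma f. *)

Import Order.TTheory GRing.Theory Num.Theory.
Import numFieldNormedType.Exports.

Local Open Scope classical_set_scope.
Local Open Scope ring_scope.

Local Notation mu := (@lebesgue_measure _).

(** * The fundamental theorem of calculus on an open interval *)

Lemma is_derive_oo_continuous {R : realType} (f F : R -> R) (a b : R) :
  {in `]a, b[, forall x : R, is_derive x (1 : R) F (f x)} ->
  {in `]a, b[, continuous F}.
Proof.
move=> dF x xab; have [dx _] := dF x xab.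
exact/differentiable_continuous/derivable1_diffP.
Qed.

Lemma FTC2_subsegment {R : realType} (f F : R -> R) (a b x y : R) :
  {in `]a, b[, continuous f} ->
  {in `]a, b[, forall x : R, is_derive x (1 : R) F (f x)} ->
  a < x -> x < y -> y < b ->
  (\int[mu]_(t in `[x, y]) (f t)%:E = (F y - F x)%:E)%E.
Proof.
move=> cf dF ax xy yb.
have sub z : z \in `[x, y] -> z \in `]a, b[.
  rewrite !in_itv/= => /andP[xz zy].
  by rewrite (lt_le_trans ax xz) (le_lt_trans zy yb).
rewrite EFinB; apply: continuous_FTC2 => //.
- by apply: continuous_in_subspaceT => z; rewrite inE => /sub/cf.
- have cF z : z \in `[x, y] -> {for z, continuous F}.
    by move=> /sub; exact: (is_derive_oo_continuous _ _ _ _ dF).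
  split.
  + by move=> z zxy; have [] := dF z (sub z (subset_itv_oo_cc zxy)).
  + by apply: cvg_at_right_filter; apply: cF; rewrite in_itv/= lexx ltW.
  + by apply: cvg_at_left_filter; apply: cF; rewrite in_itv/= lexx ltW.
- move=> z zxy; rewrite derive1E.
  by have [_ ->] := dF z (sub z (subset_itv_oo_cc zxy)).
Qed.

(** The beta kernels may be unbounded near 0 and 1, so only one-sided limits of the primitive are
    asked for. The indefinite integral [G] and [F] have the same increments inside the interval, and
    letting these increments reach either end gives the value. *)
Lemma Rintegral_oo_FTC2 {R : realType} (f F : R -> R) (a b la lb : R) : a < b ->
  {in `]a, b[, continuous f} ->
  {in `]a, b[, forall x : R, is_derive x (1 : R) F (f x)} ->
  F x @[x --> a^'+] --> la -> F x @[x --> b^'-] --> lb ->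
  mu.-integrable `[a, b] (EFin \o f) ->
  \int[mu]_(x in `[a, b]) f x = lb - la.
Proof.
move=> ab cf dF Fa Fb intf.
pose G x := parameterized_integral mu a x f.
have Gsub x y : a < x -> x < y -> y < b -> G y - G x = F y - F x.
  move=> ax xy yb; rewrite /G /parameterized_integral.
  rewrite Rintegral_itvB ?bnd_simp ?(ltW xy) ?(ltW ax)//; last first.
    apply: integrableS intf => //; apply: subset_itvl.
    by rewrite bnd_simp ltW.
  rewrite Rintegral_itv_obnd_cbnd; last first.
    apply: integrableS intf => //; move=> z.
    rewrite /= !in_itv/= => /andP[xz zy].
    by rewrite (ltW (lt_trans ax xz)) (le_trans zy (ltW yb)).
  by rewrite /Rintegral (FTC2_subsegment _ _ a b _ _ cf dF).
(* [G] and [F] are compared only strictly inside []a, b[], so an interior base point is used and the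
   two ends are reached separately. *)
pose c := (a + b) / 2.
have ac : a < c by rewrite /c midf_lt.
have cb : c < b by rewrite /c midf_lt.
have Gb := parameterized_integral_cvg_at_left ab intf.
have Ga := parameterized_integral_cvg_left ab intf.
have e1 : G b - G c = lb - F c.
  have h1 : (G x - G c) @[x --> b^'-] --> G b - G c by apply: cvgB => //; exact: cvg_cst.
  have h2 : (F x - F c) @[x --> b^'-] --> lb - F c by apply: cvgB => //; exact: cvg_cst.
  have h3 : (G x - G c) @[x --> b^'-] --> lb - F c.
    apply: cvg_trans h2; apply: near_eq_cvg.
    by near=> x; rewrite -Gsub.
  exact: (cvg_unique _ h1 h3).
have e2 : G c = F c - la.
  have h1 : (G c - G x) @[x --> a^'+] --> G c - 0.
    apply: cvgB; first exact: cvg_cst.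
    exact: (cvg_at_right_filter Ga).
  have h2 : (F c - F x) @[x --> a^'+] --> F c - la by apply: cvgB => //; exact: cvg_cst.
  rewrite -[LHS]subr0.
  have h3 : (G c - G x) @[x --> a^'+] --> F c - la.
    apply: cvg_trans h2; apply: near_eq_cvg.
    by near=> x; rewrite -Gsub.
  exact: (cvg_unique _ h1 h3).
by rewrite -/(parameterized_integral _ _ _ _) -/(G b); lra.
Unshelve. all: by end_near. Qed.

(** Over compact segments exhausting the open interval the integrals are increments of [F]. By
    monotone convergence they tend to the whole integral, which is therefore the finite number
    [lb - la]. *)
Lemma ge0_integrable_oo_derive {R : realType} (f F : R -> R) (a b la lb : R) :
  a < b -> {in `]a, b[, continuous f} ->
  {in `]a, b[, forall x : R, is_derive x (1 : R) F (f x)} ->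
  {in `]a, b[, forall x, 0 <= f x} ->
  F x @[x --> a^'+] --> la -> F x @[x --> b^'-] --> lb ->
  mu.-integrable `]a, b[ (EFin \o f).
Proof.
move=> ab cf dF f0 Fa Fb.
have ba0 : 0 < b - a by rewrite subr_gt0.
(* The denominators start at 3 so that cutting [h n] off both ends always leaves a nondegenerate
   segment. *)
pose h n : R := (b - a) / n.+3%:R.
have h_gt0 n : 0 < h n by rewrite divr_gt0.
have h_lt n : h n + h n < b - a.
  have -> : h n + h n = (b - a) * (2 / n.+3%:R) by rewrite /h; ring.
  by rewrite gtr_pMr// ltr_pdivrMr// mul1r ltr_nat.
have hnd n m : (n <= m)%N -> h m <= h n.
  by move=> nm; rewrite /h ler_pM2l// lef_pV2 ?posrE// ler_nat.
have hcvg : h n @[n --> \oo] --> 0.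
  rewrite -[X in _ --> X](mulr0 (b - a)); apply: cvgM; first exact: cvg_cst.
  have := @cvg_harmonic R; rewrite -[X in X -> _](cvg_shiftn 2).
  by apply: cvg_trans; apply: near_eq_cvg; near=> n; rewrite /= addn2.
pose S n : set R := `[(a + h n)%R, (b - h n)%R]%classic.
have Ssub n : S n `<=` `]a, b[.
  move=> x; rewrite /S/= !in_itv/= => /andP[x1 x2].
  have := h_gt0 n; lra.
have mf : measurable_fun `]a, b[ f.
  by apply: open_continuous_measurable_fun => // x; rewrite inE => /cf.
have UE : \bigcup_n S n = `]a, b[%classic.
  apply/seteqP; split=> [x [n _ /Ssub//]|x]; rewrite /= in_itv/= => /andP[ax xb].
  have := cvgr_lt _ hcvg (Num.min (x - a) (b - x)).
  rewrite lt_min !subr_gt0 ax xb => /(_ _ isT) [N _ /(_ N (leqnn _))/=].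
  rewrite lt_min => /andP[h1 h2]; exists N => //; rewrite /S/= in_itv/=; lra.
have hl : (\int[mu]_(x in S n) (f x)%:E)%E @[n --> \oo] -->
    (\int[mu]_(x in `]a, b[) (f x)%:E)%E.
  rewrite -UE; apply: ge0_nondecreasing_set_cvg_integral.
  - move=> n m nm; apply/subsetPset => x; rewrite /S /= !in_itv/=.
    by have := hnd n m nm; lra.
  - by move=> n; exact: measurable_itv.
  - by move=> n; apply/measurable_EFinP; exact: measurable_funS mf.
  - by move=> n x /Ssub xab; rewrite lee_fin f0.
have hl2 : (\int[mu]_(x in S n) (f x)%:E)%E @[n --> \oo] --> (lb - la)%:E.
  rewrite (_ : (fun n => _) = EFin \o (fun n => F (b - h n) - F (a + h n))); last first.
    apply/funext => n; rewrite /S (FTC2_subsegment _ F a b)//.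
    - by rewrite ltrDl.
    - by have := h_lt n; lra.
    - by rewrite ltrBlDr ltrDl.
  apply: cvg_EFin; first exact: nearW.
  apply: cvgB.
  - apply: ((cvg_at_leftP _ _ _).1 Fb); split.
      by move=> n; rewrite ltrBlDr ltrDl.
    by rewrite -[X in _ --> X]subr0; apply: cvgB => //; exact: cvg_cst.
  - apply: ((cvg_at_rightP _ _ _).1 Fa); split.
      by move=> n; rewrite ltrDl.
    by rewrite -[X in _ --> X]addr0; apply: cvgD => //; exact: cvg_cst.
have eqi := cvg_unique (@ereal_hausdorff R) hl hl2.
apply/integrableP; split; first exact/measurable_EFinP.
have -> : (\int[mu]_(x in `]a, b[) `|(EFin \o f) x| =
    \int[mu]_(x in `]a, b[) (f x)%:E)%E.
  apply: eq_integral => x; rewrite inE => xab.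
  by rewrite gee0_abs// lee_fin f0.
by rewrite eqi; exact: ltry.
Unshelve. all: by end_near. Qed.

(** * The beta integral *)

Definition beta_kernel {R : realType} (a b x : R) : R :=
  x `^ (a - 1) * (1 - x) `^ (b - 1).

Lemma beta_kernel_ge0 {R : realType} (a b x : R) : 0 <= beta_kernel a b x.
Proof. by rewrite mulr_ge0 ?powR_ge0. Qed.

Lemma measurable_onem_powR {R : realType} (p : R) :
  measurable_fun [set: R] (fun x : R => (1 - x) `^ p).
Proof.
apply: (measurableT_comp (measurable_powR p)).
exact: measurable_funB.
Qed.

Lemma measurable_beta_kernel {R : realType} (a b : R) :
  measurable_fun [set: R] (beta_kernel a b).
Proof.
by apply: measurable_funM; [exact: measurable_powR|exact: measurable_onem_powR].
Qed.

Lemma is_derive_onem_powR {R : realType} (b x : R) : x < 1 ->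
  is_derive x (1 : R) (fun y : R => (1 - y) `^ b) (- (b * (1 - x) `^ (b - 1))).
Proof.
move=> x1.
have h1 : is_derive (1 - x) (1 : R) (@powR R ^~ b) (b * (1 - x) `^ (b - 1)).
  by apply: is_derive1_powR; rewrite subr_gt0.
have h2 : is_derive x (1 : R) (fun y : R => 1 - y) (- 1).
  by rewrite -[- 1]sub0r; exact: is_deriveB.
by have := @is_derive1_comp R (@powR R ^~ b) (fun y => 1 - y) x _ _ h1 h2; rewrite mulrN1.
Qed.

Lemma continuous_powR {R : realType} (p x : R) : 0 < x ->
  {for x, continuous (fun y : R => y `^ p)}.
Proof.
move=> x0; have [dx _] := is_derive1_powR p x0.
exact/differentiable_continuous/derivable1_diffP.
Qed.

Lemma continuous_onem_powR {R : realType} (p x : R) : x < 1 ->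
  {for x, continuous (fun y : R => (1 - y) `^ p)}.
Proof.
move=> x1; have [dx _] := is_derive_onem_powR p x x1.
exact/differentiable_continuous/derivable1_diffP.
Qed.

Lemma cvg_onem_powR {R : realType} (p : R) : 0 < p ->
  (1 - x) `^ p @[x --> 1^'-] --> 0.
Proof.
move=> p0; apply: (@cvg_comp _ _ _ (fun x : R => 1 - x) (fun y : R => y `^ p) _ 0^'+);
  last exact: powR_cvg0.
move=> /= A [e /= e0 eA]; exists e => //= x xe x1; apply: eA => /=.
  by rewrite sub0r normrN.
by rewrite subr_gt0.
Qed.

Lemma integrable_oo_cc {R : realType} (f : R -> R) (a b : R) :
  measurable_fun [set: R] f -> mu.-integrable `]a, b[ (EFin \o f) ->
  mu.-integrable `[a, b] (EFin \o f).
Proof.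
move=> mf /integrableP[_ h]; apply/integrableP; split.
  by apply/measurable_EFinP; exact: measurable_funTS.
rewrite integral_itv_bndoo//.
apply: measurableT_comp => //; apply/measurable_EFinP; exact: measurable_funTS.
Qed.

(** The power is at most 1 when [p >= 0] and at most its value at 1/2 when [p < 0]; the sum covers
    both signs at once. *)
Lemma powR_le_halfD1 {R : realType} (p x : R) : 2^-1 <= x -> x <= 1 ->
  x `^ p <= 2^-1 `^ p + 1.
Proof.
move=> hx x1; have h0 : 0 < 2^-1 :> R by rewrite invr_gt0.
have x0 : 0 < x by exact: lt_le_trans hx.
have [p0|p0] := leP 0 p.
  rewrite (@le_trans _ _ 1) ?lerDr ?powR_ge0//.
  by have := @ge0_ler_powR R p p0 x 1; rewrite powR1 !nnegrE; apply => //; exact: ltW.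
rewrite (@le_trans _ _ (2^-1 `^ p)) ?lerDl// -[p]opprK !(powRN _ (- p)).
rewrite lef_pV2 ?posrE ?powR_gt0//.
by rewrite ge0_ler_powR// ?nnegrE ?oppr_ge0 ltW.
Qed.

(** Up to a constant this sum majorizes the beta kernel. It has an elementary primitive, whose
    one-sided limits at 0 and 1 exist because both [a] and [b] are positive. *)
Lemma integrable_powRD_onem {R : realType} (a b : R) : 0 < a -> 0 < b ->
  mu.-integrable `[0, 1] (EFin \o (fun x : R => x `^ (a - 1) + (1 - x) `^ (b - 1))).
Proof.
move=> a0 b0; apply: integrable_oo_cc.
  by apply: measurable_funD; [exact: measurable_powR|exact: measurable_onem_powR].
apply: (@ge0_integrable_oo_derive _ _
  (fun x => a^-1 * x `^ a - b^-1 * (1 - x) `^ b) _ _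
  (a^-1 * 0 - b^-1 * (1 - 0) `^ b) (a^-1 * 1 `^ a - b^-1 * 0)) => //.
- move=> x; rewrite in_itv/= => /andP[x0 x1].
  by apply: cvgD; [exact: continuous_powR|exact: continuous_onem_powR].
- move=> x; rewrite in_itv/= => /andP[x0 x1].
  have h1 := is_derive1_powR a x0.
  have h2 := is_derive_onem_powR b x x1.
  apply: is_derive_eq.
  rewrite /GRing.scale/=.
  by rewrite mulrN opprK !mulrA !mulVf ?gt_eqF// !mul1r.
- by move=> x _; rewrite addr_ge0 ?powR_ge0.
- apply: cvgB; (apply: cvgM; first exact: cvg_cst); first exact: powR_cvg0.
  by apply: cvg_at_right_filter; exact: continuous_onem_powR.
- apply: cvgB; (apply: cvgM; first exact: cvg_cst); last exact: cvg_onem_powR.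
  by apply: cvg_at_left_filter; exact: continuous_powR.
Qed.

(** On each half of the interval one of the two factors is bounded, so the product is at most a
    constant times the sum of the two powers. *)
Lemma integrable_beta_kernel {R : realType} (a b : R) : 0 < a -> 0 < b ->
  mu.-integrable `[0, 1] (EFin \o beta_kernel a b).
Proof.
move=> a0 b0; apply: integrable_oo_cc; first exact: measurable_beta_kernel.
pose C : R := (2^-1 `^ (a - 1) + 1) + (2^-1 `^ (b - 1) + 1).
have iC : mu.-integrable `]0, 1[
    (EFin \o (fun x : R => C * (x `^ (a - 1) + (1 - x) `^ (b - 1)))).
  have i01 := integrable_powRD_onem _ _ a0 b0.
  apply: (integrableS _ _ _ (integrableZl _ C i01)) => //.
  exact: subset_itv_oo_cc.
apply: (le_integrable _ _ _ iC) => //.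
  by apply/measurable_EFinP/measurable_funTS; exact: measurable_beta_kernel.
move=> x; rewrite /= in_itv/= => /andP[x0 x1].
rewrite lee_fin !ger0_norm ?beta_kernel_ge0//; last first.
  by rewrite mulr_ge0 ?addr_ge0 ?powR_ge0.
rewrite /beta_kernel /C.
have := @powR_le_halfD1 R (a - 1) x; have := @powR_le_halfD1 R (b - 1) (1 - x).
have := powR_ge0 x (a - 1); have := powR_ge0 (1 - x) (b - 1).
have := powR_ge0 (2^-1 : R) (a - 1); have := powR_ge0 (2^-1 : R) (b - 1).
move: (x `^ _) ((1 - x) `^ _) (_ `^ _) (_ `^ _) => u v p q.
move=> q0 p0 v0 u0 hv hu.
(* On the left half [hv] bounds the power of [1 - x]; on the right half [hu] bounds the power of
   [x]. *)
have [xh|xh] := leP x 2^-1.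
  have {}hv := hv ltac:(lra) ltac:(lra).
  nra.
have {}hu := hu ltac:(lra) ltac:(lra).
nra.
Qed.

(** A zero integral would force the nonnegative kernel to vanish almost everywhere, but it is
    positive on []0, 1[], a set of measure 1. *)
Lemma Beta_gt0 {R : realType} (a b : R) : 0 < a -> 0 < b -> 0 < Beta a b.
Proof.
move=> a0 b0; rewrite lt_neqAle eq_sym Rintegral_ge0 ?andbT; last first.
  by move=> x _; exact: beta_kernel_ge0.
have intk := integrable_beta_kernel _ _ a0 b0.
apply/negP => /eqP B0.
have : (\int[mu]_(x in `[0%R, 1%R]) `|(EFin \o beta_kernel a b) x| = 0)%E.
  transitivity (\int[mu]_(x in `[0%R, 1%R]) (beta_kernel a b x)%:E)%E.
    by apply: eq_integral => x _; rewrite gee0_abs// lee_fin beta_kernel_ge0.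
  rewrite -[LHS]fineK; last exact: integrable_fin_num intk.
  by congr EFin.
move/ae_eq_integral_abs => /(_ _ _)/wrap[] //.
  exact: measurable_int intk.
move=> [N [mN N0 sN]].
have : (mu `]0%R, 1%R[%classic <= mu N)%E.
  apply: le_measure; rewrite ?inE//.
  move=> x /= ; rewrite in_itv/= => /andP[x0 x1]; apply: sN => /=.
  rewrite in_itv/= !ltW// => /(_ isT)[].
  apply/eqP; rewrite gt_eqF// mulr_gt0 ?powR_gt0// subr_gt0//.
by rewrite N0 lebesgue_measure_itv/= lte_fin ltr01 -EFinB subr0 lee_fin ler10.
Qed.

(** The combination of kernels integrated below is the derivative of [x]^ a * (1 - x) [^ b], which
    tends to 0 at both ends. *)
Lemma BetaS {R : realType} (a b : R) : 0 < a -> 0 < b ->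
  Beta a (b + 1) = b / (a + b) * Beta a b.
Proof.
move=> a0 b0; have b10 : 0 < b + 1 by rewrite addr_gt0.
have i0 := integrable_beta_kernel _ _ a0 b0.
have i1 := integrable_beta_kernel _ _ a0 b10.
have j1 : mu.-integrable `[0, 1]
    (EFin \o (fun x : R => (a + b) * beta_kernel a (b + 1) x)).
  by apply: (integrableZl _ _ i1).
have j0 : mu.-integrable `[0, 1] (EFin \o (fun x : R => b * beta_kernel a b x)).
  by apply: (integrableZl _ _ i0).
have : \int[mu]_(x in `[0, 1])
    ((a + b) * beta_kernel a (b + 1) x - b * beta_kernel a b x) = 0.
  rewrite (@Rintegral_oo_FTC2 _ _ (fun x : R => x `^ a * (1 - x) `^ b) _ _
    (0 * (1 - 0) `^ b) (1 `^ a * 0)) ?mulr0 ?mul0r ?subrr//.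
  - move=> x; rewrite in_itv/= => /andP[x0 x1].
    apply: cvgB; (apply: cvgM; first exact: cvg_cst);
      (apply: cvgM; [exact: continuous_powR|exact: continuous_onem_powR]).
  - move=> x; rewrite in_itv/= => /andP[x0 x1].
    have h1 := is_derive1_powR a x0.
    have h2 := is_derive_onem_powR b x x1.
    apply: is_derive_eq.
    rewrite /GRing.scale/= /beta_kernel addrK.
    have y0 : 0 < 1 - x by rewrite subr_gt0.
    rewrite -(mulr_powRB1 (ltW x0) a0) -(mulr_powRB1 (ltW y0) b0).
    ring.
  - rewrite -[X in _ --> X](mul0r (1 `^ b)).
    apply: cvgM; first exact: powR_cvg0.
    rewrite -[X in X `^ b]subr0; apply: cvg_at_right_filter.
    exact: continuous_onem_powR.
  - rewrite -[X in _ --> X](mulr0 (1 `^ a)).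
    apply: cvgM; last exact: cvg_onem_powR.
    by apply: cvg_at_left_filter; exact: continuous_powR.
  - by apply: (integrableB _ j1 j0).
rewrite RintegralB// !RintegralZl// => /subr0_eq.
rewrite -/(Beta _ _) -/(Beta _ _) => h.
have ab0 : a + b != 0 by rewrite gt_eqF ?addr_gt0.
by apply: (mulfI ab0); rewrite mulrA mulrCA divff// mulr1.
Qed.

Lemma risingS {R : realType} (a : R) n : rising a n.+1 = rising a n * (a + n%:R).
Proof. by rewrite /rising big_ord_recr. Qed.

Lemma rising_gt0 {R : realType} (a : R) n : 0 < a -> 0 < rising a n.
Proof. by move=> a0; apply: prodr_gt0 => i _; rewrite ltr_wpDr. Qed.

(** This turns the ratio of rising factorials in the Gauss series into a ratio of beta integrals. *)
Lemma Beta_addn {R : realType} (a b : R) n : 0 < a -> 0 < b ->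
  Beta a (b + n%:R) = rising b n / rising (a + b) n * Beta a b.
Proof.
move=> a0 b0; elim: n => [|n IH].
  by rewrite /rising !big_ord0 addr0 divr1 mul1r.
rewrite -natr1 addrA BetaS// ?ltr_wpDr// IH !risingS addrA invfM; ring.
Qed.

(** * The binomial series *)

Lemma exists_norm_between {R : realFieldType} (x y : R) : `|x| < y ->
  exists2 r : R, `|x| < `|r| & `|r| < y.
Proof.
move=> xy; pose r := (`|x| + y) / 2; have xr : `|x| < r by rewrite /r midf_lt.
exists r; rewrite (@ger0_norm _ r) ?(le_trans _ (ltW xr))//.
by rewrite /r midf_lt.
Qed.

(** A tangent-line bound for the convex power function; it absorbs the factor [n.+1] created by
    differentiating a power series. *)
Lemma natr_exprM_le_subrXX {R : realType} (x r : R) n : 0 <= x -> x <= r ->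
  n.+1%:R * x ^+ n * (r - x) <= r ^+ n.+1 - x ^+ n.+1.
Proof.
move=> x0 xr; elim: n => [|n IH]; first by rewrite expr0 !expr1 !mul1r.
have -> : r ^+ n.+2 - x ^+ n.+2 = r * (r ^+ n.+1 - x ^+ n.+1) + x ^+ n.+1 * (r - x).
  by rewrite !(exprS _ n.+1); ring.
have -> : n.+2%:R * x ^+ n.+1 * (r - x) =
    x * (n.+1%:R * x ^+ n * (r - x)) + x ^+ n.+1 * (r - x).
  by rewrite -natr1 exprS; ring.
rewrite lerD2r (le_trans _ (ler_wpM2l (le_trans x0 xr) IH))// ler_wpM2r//.
by rewrite !mulr_ge0 ?exprn_ge0 ?subr_ge0.
Qed.

(** For [s] strictly between the two norms, the factor [n.+1 * |x|^n] is at most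
    [s^(n+1) / (s - |x|)], so the derived series is dominated by the absolutely convergent series at
    [s]. *)
Lemma is_cvg_pseries_diffs {R : realType} (c : R^nat) (x r : R) :
  cvgn (pseries c r) -> `|x| < `|r| -> cvgn (pseries (pseries_diffs c) x).
Proof.
move=> cr xr; pose s := (`|x| + `|r|) / 2.
have xs : `|x| < s by rewrite /s midf_lt.
have s0 : 0 < s by rewrite (le_lt_trans _ xs).
have sr : s < `|r| by rewrite /s midf_lt.
have cs : cvgn (pseries (fun i => `|c i|) s).
  by apply: is_cvg_pseries_inside_norm cr _; rewrite gtr0_norm.
have cs1 : cvgn (series (fun i => `|c i.+1| * s ^+ i.+1)).
  have -> : series (fun i => `|c i.+1| * s ^+ i.+1) =
      (fun n => pseries (fun i => `|c i|) s n.+1 - `|c 0%N| * s ^+ 0).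
    by apply/funext => n; rewrite /pseries /series/= [in RHS]big_nat_recl//= addrC addKr.
  apply: is_cvgB; last exact: is_cvg_cst.
  by move/cvg_ex: cs => [l cl]; apply/cvg_ex; exists l; rewrite cvg_shiftS.
apply: normed_cvg.
have cs2 : cvgn (series (fun i => (s - `|x|)^-1 * (`|c i.+1| * s ^+ i.+1))).
  exact: is_cvg_seriesZ.
apply: series_le_cvg cs2 => [n|n|n] //=.
  by rewrite !mulr_ge0 ?exprn_ge0 ?invr_ge0 ?subr_ge0// ltW.
rewrite /pseries_diffs !normrM normr_nat normrX mulrAC mulrC.
rewrite ler_pdivlMl ?subr_gt0// mulrCA ler_wpM2l//.
rewrite mulrC; apply: le_trans (natr_exprM_le_subrXX _ _ n _ (ltW xs)) _ => //.
by rewrite gerBl exprn_ge0.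
Qed.

(* [(-1)^n] times the binomial coefficient [g] over [n]. *)
Definition signed_binom {R : realType} (g : R) (n : nat) : R :=
  rising (- g) n / n`!%:R.

(** This recurrence yields both the absolute summability, by telescoping, and the differential
    equation of the binomial series. *)
Lemma signed_binomS {R : realType} (g : R) n :
  n.+1%:R * signed_binom g n.+1 = (n%:R - g) * signed_binom g n.
Proof.
rewrite /signed_binom risingS factS natrM invfM.
have : n.+1%:R != 0 :> R by rewrite pnatr_eq0.
by move=> n0; rewrite mulrCA [X in _ * X]mulrA mulfV//; ring.
Qed.

Lemma signed_binom0 {R : realType} (g : R) : signed_binom g 0 = 1.
Proof. by rewrite /signed_binom /rising big_ord0 fact0 divr1. Qed.

(** Summability at the boundary point 1 is what later gives a majorant uniform up to [phi = 1]. The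
    case [g = 0], where only the constant term survives, is set apart because the general bound
    divides by [g]. *)
Lemma signed_binom_abs_summable {R : realType} (g : R) : 0 <= g ->
  exists K, forall n, \sum_(0 <= i < n) `|signed_binom g i| <= K.
Proof.
rewrite le_eqVlt => /predU1P[<-|g0].
  have c0 n : signed_binom (0 : R) n.+1 = 0.
    have nz k : k.+1%:R != 0 :> R by rewrite pnatr_eq0.
    elim: n => [|n IH]; [apply: (mulfI (nz 0%N))|apply: (mulfI (nz n.+1))].
      by rewrite signed_binomS subrr mul0r mulr0.
    by rewrite signed_binomS IH !mulr0.
  exists 1 => -[|n]; first by rewrite big_geq.
  rewrite big_nat_recl// signed_binom0 normr1 big1 ?addr0// => i _.
  by rewrite c0 normr0.
pose u n := \sum_(0 <= i < n) `|signed_binom g i|.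
have u_nd n m : (n <= m)%N -> u n <= u m.
  move=> nm; rewrite /u (big_cat_nat (n := n) (p := m))//= lerDl.
  by apply: sumr_ge0.
have [N gN] : exists N : nat, g <= N%:R.
  by exists (Num.bound g); apply/ltW/archi_boundP/ltW.
(* For [n >= g] the recurrence gives
   [g |c_n| = n |c_n| - (n + 1) |c_(n + 1)|], which telescopes. *)
have tele k : g * (u (N + k)%N - u N) =
    N%:R * `|signed_binom g N| - (N + k)%:R * `|signed_binom g (N + k)|.
  elim: k => [|k IH]; first by rewrite addn0 !subrr mulr0.
  have h : (N + k).+1%:R * `|signed_binom g (N + k).+1| =
      ((N + k)%:R - g) * `|signed_binom g (N + k)|.
    have e : 0 <= (N + k)%:R - g.
      by rewrite subr_ge0 (le_trans gN)// ler_nat leq_addr.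
    have := congr1 Num.norm (signed_binomS g (N + k)).
    by rewrite !normrM normr_nat (ger0_norm e).
  rewrite addnS h /u big_nat_recr//= -/(u _).
  have -> : g * (u (N + k)%N + `|signed_binom g (N + k)| - u N) =
     g * (u (N + k)%N - u N) + g * `|signed_binom g (N + k)| by ring.
  by rewrite IH; ring.
(* The terms from [N] on contribute at most the first term of the telescoped expression divided by
   [g], since the subtracted term is nonnegative. *)
exists (u N + g^-1 * (N%:R * `|signed_binom g N|)) => n.
apply: (le_trans (u_nd n (N + n)%N (leq_addl _ _))).
rewrite -lerBlDl ler_pdivlMl// tele gerBl.
by rewrite mulr_ge0.
Qed.

Lemma is_cvg_pseries_signed_binom {R : realType} (g x : R) : 0 <= g -> `|x| < 1 ->
  cvgn (pseries (signed_binom g) x).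
Proof.
move=> g0 x1; apply: (@is_cvg_pseries_inside _ _ 1); last by rewrite normr1.
have [K hK] := signed_binom_abs_summable g g0.
apply: normed_cvg; apply: nondecreasing_is_cvgn.
  by apply: nondecreasing_series => n _ _; exact: normr_ge0.
exists K => _ [n _ <-] /=; apply: le_trans (hK n); rewrite /series/=.
by apply: ler_sum => i _; rewrite expr1n mulr1.
Qed.

Lemma signed_binom_ode {R : realType} (g x : R) : 0 <= g -> `|x| < 1 ->
  (1 - x) * limn (pseries (pseries_diffs (signed_binom g)) x) =
  - g * limn (pseries (signed_binom g) x).
Proof.
move=> g0 x1; set c := signed_binom g.
have [r xr r1] : exists2 r : R, `|x| < `|r| & `|r| < 1.
  exact: exists_norm_between.
have cc : cvgn (pseries c x) by exact: is_cvg_pseries_signed_binom.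
have cd : cvgn (pseries (pseries_diffs c) x).
  by apply: is_cvg_pseries_diffs xr; exact: is_cvg_pseries_signed_binom.
have h := pseries_diffs_equiv cd.
(* Termwise this is the recurrence. The truncated exponent [i.-1] is harmless at [i = 0], where the
   coefficient is 0; by [h], the re-indexed series has the same sum as the derived one. *)
have E : pseries (pseries_diffs c) x =
    (fun n => x * series (fun i => i%:R * c i * x ^+ i.-1) n - g * pseries c x n).
  apply/funext => n; rewrite /pseries /series/= !mulr_sumr -sumrB.
  apply: eq_bigr => -[|i] _; rewrite /pseries_diffs signed_binomS -/c.
    by rewrite !mul0r mulr0; ring.
  by rewrite [i.+1.-1]/= exprS; ring.
have : pseries (pseries_diffs c) x @ \oo -->
    x * limn (pseries (pseries_diffs c) x) - g * limn (pseries c x).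
  rewrite {1}E; apply: cvgB; (apply: cvgM; first exact: cvg_cst) => //.
move/cvg_lim => /(_ (@Rhausdorff R)); lra.
Qed.

Lemma binomial_series {R : realType} (g y : R) : 0 <= g -> 0 <= y < 1 ->
  pseries (signed_binom g) y @ \oo --> (1 - y) `^ g.
Proof.
move=> g0 /andP[y0 y1]; set c := signed_binom g.
have cvc (x : R) : `|x| < 1 -> cvgn (pseries c x) by exact: is_cvg_pseries_signed_binom.
have between (x : R) : `|x| < 1 -> exists2 r : R, `|x| < `|r| & `|r| < 1.
  exact: exists_norm_between.
have cvd (x : R) : `|x| < 1 -> cvgn (pseries (pseries_diffs c) x).
  by move=> /between[r xr r1]; exact: (is_cvg_pseries_diffs _ _ r (cvc _ r1)).
(* Termwise differentiation through [pseries_snd_diffs] uses the series and its first two formal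
   derivatives at a point of larger norm. *)
have cvdd (x : R) : `|x| < 1 -> cvgn (pseries (pseries_diffs (pseries_diffs c)) x).
  by move=> /between[r xr r1]; exact: (is_cvg_pseries_diffs _ _ r (cvd _ r1)).
pose f x := limn (pseries c x).
pose df x := limn (pseries (pseries_diffs c) x).
have fD x : `|x| < 1 -> is_derive x (1 : R) f (df x).
  move=> /between[r xr r1].
  by apply: (@pseries_snd_diffs _ _ r) => //; [exact: cvc|exact: cvd|exact: cvdd].
pose h x := f x * (1 - x) `^ (- g).
have hD x : `|x| < 1 -> is_derive x (1 : R) h 0.
  move=> x1; have x1' : x < 1 by exact: le_lt_trans (ler_norm _) x1.
  have h1 := fD x x1; have h2 := is_derive_onem_powR (- g) x x1'.
  apply: is_derive_eq; rewrite /GRing.scale/=.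
  have nz : 1 - x != 0 by rewrite subr_eq0 gt_eqF.
  (* Splitting off one factor [1 - x] makes the left side of the differential equation appear. *)
  have -> : (1 - x) `^ (- g) = (1 - x) * (1 - x) `^ (- g - 1).
    rewrite -{2}[1 - x]powRr1 ?subr_ge0 ?ltW// -powRD ?nz ?implybT//.
    by congr (_ `^ _); ring.
  have := signed_binom_ode g x g0 x1; rewrite -/c -/(f x) -/(df x) => e.
  have -> : f x * - (- g * (1 - x) `^ (- g - 1)) +
      (1 - x) * (1 - x) `^ (- g - 1) * df x =
      (1 - x) `^ (- g - 1) * ((1 - x) * df x - (- g * f x)) by ring.
  by rewrite e subrr mulr0.
have lt1 x : 0 <= x -> x <= y -> `|x| < 1.
  by move=> x0 xy; rewrite ger0_norm// (le_lt_trans xy).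
have [|||z _] := @MVT_segment R h (cst 0) 0 y.
- by [].
- move=> x; rewrite in_itv/= => /andP[x0 xy]; apply: hD.
  by apply: lt1; exact: ltW.
- apply: derivable_within_continuous => x; rewrite in_itv/= => /andP[x0 xy].
  by have [] := hD x (lt1 _ x0 xy).
rewrite /= mul0r => /subr0_eq; rewrite /h subr0 powR1 mulr1.
have -> : f 0 = 1.
  apply/cvg_lim => //; rewrite -[X in X --> _]/(pseries c 0 @ \oo) -cvg_shiftS.
  (* The partial sum of index 0 is empty; after the shift by one, all partial sums equal 1. *)
  rewrite (_ : (fun n => _) = cst 1); first exact: cvg_cst.
  apply/funext => n.
  rewrite /pseries /series/= big_nat_recl//= expr0 mulr1 /c signed_binom0.
  by rewrite big1 ?addr0// => i _; rewrite expr0n/= mulr0.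
rewrite powRN => e.
have p0 : (1 - y) `^ g != 0 by rewrite gt_eqF// powR_gt0// subr_gt0.
have <- : f y = (1 - y) `^ g by apply: (mulIf (invr_neq0 p0)); rewrite e divff.
exact: cvc _ (lt1 _ y0 (lexx _)).
Unshelve. all: by end_near. Qed.

(** * Euler's integral formula *)

(** At [x = 0] exponents may be added only when their sum is nonzero. For a positive number of
    factors the sum is positive, as [a > 0]; the case [n = 0] is trivial. *)
Lemma powRB1_exprn {R : realType} (a x : R) n : 0 < a -> 0 <= x ->
  x `^ (a - 1) * x ^+ n = x `^ (a + n%:R - 1).
Proof.
move=> a0 x0; case: n => [|n]; first by rewrite expr0 mulr1 addr0.
have e : a - 1 + n.+1%:R = a + n%:R by rewrite -natr1; ring.
rewrite -powR_mulrn// -powRD; first by rewrite addrAC.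
by rewrite e gt_eqF// ltr_wpDr.
Qed.

Lemma beta_kernel_exprn {R : realType} (a b phi x : R) n : 0 < b -> x <= 1 ->
  beta_kernel a b x * (phi * (1 - x)) ^+ n =
  phi ^+ n * beta_kernel a (b + n%:R) x.
Proof.
move=> b0 x1; rewrite /beta_kernel -(powRB1_exprn b) ?subr_ge0// exprMn; ring.
Qed.

(** Each new term only raises the second beta parameter. Integrability and value are proved in one
    induction because additivity of the integral requires the former. *)
Lemma Rintegral_beta_kernel_pseries {R : realType} (a b phi : R) (c : R^nat) n :
  0 < a -> 0 < b ->
  mu.-integrable `[0, 1]
    (EFin \o (fun x : R => beta_kernel a b x * pseries c (phi * (1 - x)) n)) /\
  \int[mu]_(x in `[0, 1]) (beta_kernel a b x * pseries c (phi * (1 - x)) n) =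
    \sum_(0 <= i < n) c i * phi ^+ i * Beta a (b + i%:R).
Proof.
move=> a0 b0; elim: n => [|n [intn IH]].
  have e : (fun x : R => beta_kernel a b x * pseries c (phi * (1 - x)) 0) = cst 0.
    by apply/funext => x; rewrite /pseries /series/= big_geq// mulr0.
  rewrite e big_geq//; split; first exact: integrable0.
  by rewrite Rintegral_cst//= mul0r.
have bn : 0 < b + n%:R by rewrite ltr_wpDr.
have ik := integrable_beta_kernel _ _ a0 bn.
have iZ : mu.-integrable `[0, 1]
    (EFin \o (fun x : R => c n * phi ^+ n * beta_kernel a (b + n%:R) x)).
  by apply: (integrableZl _ _ ik).
have e : {in `[0, 1], forall x : R,
    beta_kernel a b x * pseries c (phi * (1 - x)) n.+1 =
    beta_kernel a b x * pseries c (phi * (1 - x)) n +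
    c n * phi ^+ n * beta_kernel a (b + n%:R) x}.
  move=> x; rewrite in_itv/= => /andP[x0 x1].
  rewrite /pseries seriesSr/= mulrDr; congr (_ + _).
  by rewrite mulrCA beta_kernel_exprn// mulrA.
split.
  by apply: (eq_integrable _ _ _ _ (integrableD _ intn iZ)) => // x;
    rewrite inE/= => /e ->.
rewrite big_nat_recr//= -IH.
transitivity (\int[mu]_(x in `[0, 1])
    (beta_kernel a b x * pseries c (phi * (1 - x)) n +
     c n * phi ^+ n * beta_kernel a (b + n%:R) x)).
  by apply: eq_Rintegral => x; rewrite inE/= => /e.
by rewrite RintegralD// RintegralZl.
Qed.

Lemma rpushbeta_kernelE {R : realType} (a b g phi x : R) :
  rpushbeta_kernel a b g phi x = beta_kernel a b x * (1 - phi * (1 - x)) `^ g.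
Proof.
by rewrite /rpushbeta_kernel /beta_kernel; congr (_ * _ `^ _); ring.
Qed.

Lemma rpushbeta_kernel_ge0 {R : realType} (a b g phi x : R) :
  0 <= rpushbeta_kernel a b g phi x.
Proof. by rewrite rpushbeta_kernelE mulr_ge0 ?powR_ge0 ?beta_kernel_ge0. Qed.

Lemma measurable_rpushbeta_kernel {R : realType} (a b g phi : R) :
  measurable_fun [set: R] (rpushbeta_kernel a b g phi).
Proof.
apply: measurable_funM; first exact: measurable_beta_kernel.
apply: (measurableT_comp (measurable_powR g)).
by apply: measurable_funD => //; exact: measurable_funM.
Qed.

Lemma integrable_rpushbeta_kernel {R : realType} (a b g phi : R) :
  0 < a -> 0 < b -> 0 <= g -> 0 <= phi -> phi <= 1 ->
  mu.-integrable `[0, 1] (EFin \o rpushbeta_kernel a b g phi).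
Proof.
move=> a0 b0 g0 p0 p1; have ik := integrable_beta_kernel _ _ a0 b0.
apply: (le_integrable _ _ _ ik) => //.
  by apply/measurable_EFinP/measurable_funTS; exact: measurable_rpushbeta_kernel.
move=> x; rewrite /= in_itv/= => /andP[x0 x1].
rewrite lee_fin !ger0_norm ?beta_kernel_ge0 ?rpushbeta_kernel_ge0//.
rewrite rpushbeta_kernelE ler_piMr ?beta_kernel_ge0//.
have y0 : 0 <= phi * (1 - x) by rewrite mulr_ge0 ?subr_ge0.
have y1 : phi * (1 - x) <= 1 by rewrite mulr_ile1 ?subr_ge0// gerBl.
have := @ge0_ler_powR R g g0 (1 - phi * (1 - x)) 1; rewrite powR1 !nnegrE.
by apply; rewrite ?subr_ge0// gerBl.
Qed.

(** Convergence of the Gauss series is not assumed: its partial sums, times [Beta a b], are the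
    integrals of the truncated binomial expansions, and dominated convergence provides their
    limit. *)
Lemma euler_hyp2F1 {R : realType} (a b g phi : R) :
  0 < a -> 0 < b -> 0 <= g -> 0 <= phi -> phi <= 1 ->
  \int[mu]_(x in `[0, 1]) rpushbeta_kernel a b g phi x =
  Beta a b * hyp2F1 (- g) b (a + b) phi.
Proof.
move=> a0 b0 g0 p0 p1; pose c := signed_binom g.
have [K hK] := signed_binom_abs_summable g g0.
have B0 := Beta_gt0 _ _ a0 b0.
have ik := integrable_beta_kernel _ _ a0 b0.
pose f_ n (x : R) := beta_kernel a b x * pseries c (phi * (1 - x)) n.
have intf n : mu.-integrable `[0, 1] (EFin \o f_ n).
  exact: (Rintegral_beta_kernel_pseries _ _ _ _ n a0 b0).1.
have iK : mu.-integrable `[0, 1] (EFin \o (fun x : R => K * beta_kernel a b x)).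
  by apply: (integrableZl _ _ ik).
have y01 (x : R) : x \in `[0, 1] -> 0 <= phi * (1 - x) /\ phi * (1 - x) <= 1.
  rewrite in_itv/= => /andP[x0 x1].
  by rewrite mulr_ge0 ?subr_ge0// mulr_ile1 ?subr_ge0// gerBl.
have := @dominated_convergence _ _ _ mu `[0%R, 1%R] _
  (fun n => EFin \o f_ n) (EFin \o rpushbeta_kernel a b g phi)
  (EFin \o (fun x => K * beta_kernel a b x)).
move=> /(_ _ _ _ _ iK _)/wrap[] //.
- by move=> n; exact: measurable_int (intf n).
- by apply/measurable_EFinP/measurable_funTS; exact: measurable_rpushbeta_kernel.
(* The point 0 is discarded because for [phi = 1] the argument [phi * (1 - x)] equals 1 there,
   outside the range of [binomial_series]. *)
- exists [set 0]; split => //; first exact: lebesgue_measure_set1.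
  move=> x /=; apply: contra_notP => x0 x01; apply: cvg_EFin; first exact: nearW.
  rewrite /= rpushbeta_kernelE; apply: cvgM; first exact: cvg_cst.
  apply: binomial_series => //.
  have [-> _] := y01 x x01; move: x01; rewrite in_itv/= => /andP[x0' x1].
  have xp : 0 < x by rewrite lt_neqAle x0' andbT; apply/eqP => x00; apply: x0.
  by rewrite (le_lt_trans (ler_piMl _ p1)) ?subr_ge0// gtrBl.
- apply: aeW => x n x01; rewrite lee_fin normrM (ger0_norm (beta_kernel_ge0 _ _ _)).
  rewrite mulrC ler_wpM2r ?beta_kernel_ge0//.
  apply: le_trans (hK n); rewrite /pseries /series/=.
  apply: le_trans (ler_norm_sum _ _ _) _; apply: ler_sum => i _.
  have [y0 y1] := y01 x x01.
  by rewrite normrM ler_piMr// ger0_norm ?exprn_ge0// exprn_ile1.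
move=> [_ _].
have irp := integrable_rpushbeta_kernel _ _ _ _ a0 b0 g0 p0 p1.
pose t n := rising (- g) n * rising b n / rising (a + b) n * (phi ^+ n / n`!%:R).
rewrite (_ : (fun n => _) = EFin \o (fun n => Beta a b * series t n)); last first.
  apply/funext => n /=.
  have [i1 i2] := Rintegral_beta_kernel_pseries a b phi c n a0 b0.
  rewrite -[LHS]fineK; last exact: integrable_fin_num i1.
  congr EFin; rewrite [LHS]i2 /series/= mulr_sumr; apply: eq_bigr => i _.
  by rewrite Beta_addn// /t /c /signed_binom; ring.
rewrite -[X in _ --> X]fineK; last exact: integrable_fin_num irp.
move=> /fine_cvgP[_ h].
have ht : series t @ \oo -->
    (\int[mu]_(x in `[0, 1]) rpushbeta_kernel a b g phi x) / Beta a b.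
  have -> : series t = (fun n => (Beta a b * series t n) / Beta a b).
    by apply/funext => n; rewrite mulrAC divff ?mul1r// gt_eqF.
  by apply: cvgM; [exact: h|exact: cvg_cst].
have -> : hyp2F1 (- g) b (a + b) phi =
    (\int[mu]_(x in `[0, 1]) rpushbeta_kernel a b g phi x) / Beta a b.
  exact/cvg_lim.
by rewrite mulrCA divff ?mulr1// gt_eqF.
Qed.

(** * Moments *)

(** Since [p] and the Radon-Nikodym derivative have the same integral over every measurable set,
    they agree almost everywhere, and the change of variables for the latter passes to [p]. *)
Lemma ge0_integral_density {d : measure_display} {T : measurableType d}
    {R : realType} (nu : {finite_measure set T -> \bar R})
    (m : {sigma_finite_measure set T -> \bar R}) (p : T -> R) (f : T -> \bar R) :
  measurable_fun [set: T] p -> (forall x, 0 <= p x) ->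
  (forall A, measurable A -> nu A = (\int[m]_(x in A) (p x)%:E)%E) ->
  measurable_fun [set: T] f -> (forall x, (0 <= f x)%E) ->
  (\int[nu]_x f x = \int[m]_x (f x * (p x)%:E))%E.
Proof.
move=> mp p0 nup mf f0.
have mpE : measurable_fun [set: T] (EFin \o p) by exact/measurable_EFinP.
have numu : nu `<< m.
  apply/null_content_dominatesP => A mA mA0; rewrite nup//.
  by apply: null_set_integral => //; exact: measurable_funTS.
have intp : m.-integrable [set: T] (EFin \o p).
  apply/integrableP; split => //.
  under eq_integral do rewrite gee0_abs ?lee_fin//.
  by rewrite -nup// ltey_eq fin_num_measure.
rewrite -(Radon_Nikodym_SigmaFinite.change_of_variables numu)//.
have intrn := Radon_Nikodym_SigmaFinite.f_integrable numu.
apply: ae_eq_integral => //.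
- by apply: emeasurable_funM => //; exact: measurable_int intrn.
- exact: emeasurable_funM.
apply: ae_eqe_mul2l; apply: integral_ae_eq => // E _ mE.
by rewrite -nup// -Radon_Nikodym_SigmaFinite.f_integral.
Qed.

Lemma rpushbeta_pdf_ge0 {R : realType} (a b g phi x : R) :
  0 <= rpushbeta_pdf a b g phi x.
Proof.
rewrite /rpushbeta_pdf patchE; case: ifPn => // _.
rewrite divr_ge0 ?rpushbeta_kernel_ge0// Rintegral_ge0// => y _.
exact: rpushbeta_kernel_ge0.
Qed.

Lemma measurable_rpushbeta_pdf {R : realType} (a b g phi : R) :
  measurable_fun [set: R] (rpushbeta_pdf a b g phi).
Proof.
apply/(measurable_restrictT _ _).1 => //.
apply: measurable_funTS; apply: measurable_funM => //.
exact: measurable_rpushbeta_kernel.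
Qed.

Lemma rpushbeta_expectation_expn {d : measure_display} {T : measurableType d}
    {R : realType} (P : probability T R) (X : {RV P >-> R})
    (a b g phi : R) (k : nat) :
  is_rpushbeta X a b g phi ->
  ('E_P[fun w => (X w ^+ k)%R] =
   \int[mu]_(x in `[0%R, 1%R])
     (x ^+ k * rpushbeta_kernel a b g phi x /
        \int[mu]_(t in `[0, 1]) rpushbeta_kernel a b g phi t)%:E)%E.
Proof.
move=> XD; rewrite unlock.
(* Outside [[0, 1]] odd powers can be negative. Cutting them off there gives a nonnegative function,
   and [X] leaves [[0, 1]] with probability 0. *)
pose h : R -> R := (fun x : R => x ^+ k) \_ `[0, 1].
have mh : measurable_fun [set: R] h.
  by apply/(measurable_restrictT _ _).1.
have h0 x : 0 <= h x.
  rewrite /h patchE; case: ifPn => //; rewrite inE/= in_itv/= => /andP[x0 _].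
  exact: exprn_ge0.
have mhE : measurable_fun [set: R] (EFin \o h) by exact/measurable_EFinP.
have m01 : measurable (`[0, 1]%classic : set R) by [].
have P01 : P (X @^-1` ~` `[0, 1]) = 0%E.
  have -> : P (X @^-1` ~` `[0, 1]) = distribution P X (~` `[0, 1]) by [].
  rewrite XD; last exact: measurableC.
  rewrite /rpushbeta_prob; apply: integral0_eq => x nx.
  by rewrite /rpushbeta_pdf patchE memNset.
transitivity (\int[P]_w ((EFin \o h) \o X) w)%E.
  apply: ae_eq_integral => //.
  - by apply/measurable_EFinP; apply: (measurableT_comp (exprn_measurable k)).
  - exact: measurableT_comp.
  exists (X @^-1` ~` `[0, 1]); split => //.
    rewrite -[X in measurable X]setTI; apply: measurable_funP => //.
    exact: measurableC.
  move=> w /=; apply: contra_not => + _.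
  by rewrite /h /= patchE => Xw; rewrite mem_set.
(* The Borel structures of [R] and [measurableTypeR R] have the same measurable
   sets but different displays; Lebesgue measure lives on the latter. *)
have mY : measurable_fun [set: T] (X : T -> measurableTypeR R).
  exact: (@measurable_funPT _ _ _ _ X).
pose Y : {mfun T >-> measurableTypeR R} :=
  HB.pack (X : T -> measurableTypeR R) (isMeasurableFun.Build _ _ _ _ _ mY).
have YE := @ge0_integral_distribution _ _ _ _ _ P Y (EFin \o h).
rewrite -YE//.
transitivity (\int[mu]_x ((EFin \o h) x * (rpushbeta_pdf a b g phi x)%:E))%E.
  apply: (ge0_integral_density (distribution P Y) mu) => //.
  - exact: measurable_rpushbeta_pdf.
  - by move=> x; exact: rpushbeta_pdf_ge0.
rewrite [RHS]integral_mkcond; apply: eq_integral => x _.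
rewrite /= /h /rpushbeta_pdf !patchE; case: ifPn => _; last by rewrite mul0e.
by rewrite -EFinM mulrA.
Qed.

Theorem mainTheorem12 (R : realType) (d : measure_display)
    (T : measurableType d) (P : probability T R) (X : {RV P >-> R})
    (alpha beta gamma phi : R)
    (alpha_gt0 : 0 < alpha) (beta_gt0 : 0 < beta) (gamma_ge0 : 0 <= gamma)
    (phi_ge0 : 0 <= phi) (phi_le1 : phi <= 1)
    (X_rpushbeta : is_rpushbeta X alpha beta gamma phi)
    (k : nat) (k_ge1 : (1 <= k)%N) :
  ('E_P[fun w => (X w ^+ k)%R])%E =
     (Beta (alpha + k%:R) beta / Beta alpha beta *
      (hyp2F1 (- gamma) beta (alpha + beta + k%:R) phi /
       hyp2F1 (- gamma) beta (alpha + beta) phi))%:E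
  /\
  ('E_P[fun w => (X w ^+ k)%R])%E =
     ((\int[lebesgue_measure]_(x in `[0, 1])
         (x `^ (alpha + k%:R - 1) * (1 - x) `^ (beta - 1) *
          (1 - phi + x * phi) `^ gamma)) /
      (\int[lebesgue_measure]_(x in `[0, 1])
         (x `^ (alpha - 1) * (1 - x) `^ (beta - 1) *
          (1 - phi + x * phi) `^ gamma)))%:E.
Proof.
have alphak_gt0 : 0 < alpha + k%:R by rewrite ltr_wpDr.
set E := ('E_P[_])%E; set Ik := \int[mu]_(x in _) _; set I := \int[mu]_(x in _) _.
(* The integral form comes first; Euler's formula, with [alpha + k%:R] above and [alpha] below, then
   converts it into the hypergeometric form. *)
have EI : E = (Ik / I)%:E.
  have ik := integrable_rpushbeta_kernel _ _ _ _ alphak_gt0 beta_gt0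
    gamma_ge0 phi_ge0 phi_le1.
  rewrite /E (rpushbeta_expectation_expn _ _ _ _ _ _ _ X_rpushbeta) -/I.
  transitivity (\int[mu]_(x in `[0%R, 1%R])
      ((rpushbeta_kernel (alpha + k%:R) beta gamma phi x)%:E * I^-1%:E))%E.
    apply: eq_integral => x; rewrite inE/= in_itv/= => /andP[x0 x1].
    rewrite -EFinM; congr (_ * _)%:E.
    by rewrite /rpushbeta_kernel -powRB1_exprn//; ring.
  rewrite integralZr// EFinM; congr (_ * _)%E.
  by rewrite -[LHS]fineK//; exact: integrable_fin_num ik.
split=> //; rewrite EI; congr EFin.
have -> : Ik = Beta (alpha + k%:R) beta *
    hyp2F1 (- gamma) beta (alpha + k%:R + beta) phi by exact: euler_hyp2F1.
have -> : I = Beta alpha beta * hyp2F1 (- gamma) beta (alpha + beta) phi.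
  exact: euler_hyp2F1.
by rewrite (addrAC alpha) invfM; ring.
Qed.
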